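(* Let $l,p,m,n,k,r$ be positive integers. Suppose that a linear subspace $\mathcal{L}\subseteq\mathbb{M}_{lp}$ is $k$-transitive and is spanned by its elements of rank $r$. If a linear subspace $\mathcal{M}\subseteq\mathbb{M}_{mn}$ is $rk$-transitive, then $\mathcal{L}\otimes\mathcal{M}$ is $k$-transitive.
   Context: $\mathbb{M}_{mn}$ is the complex vector space of $m\times n$ complex matrices, identified with the linear maps $\mathbb{C}^n\to\mathbb{C}^m$. A linear subspace $\mathcal{L}\subseteq\mathbb{M}_{mn}$ is $k$-transitive if for every choice of $k$ linearly independent vectors $x_1,\dots,x_k\in\mathbb{C}^n$ and arbitrary vectors $y_1,\dots,y_k\in\mathbb{C}^m$ there is $A\in\mathcal{L}$ with $Ax_i=y_i$ for $1\le i\le k$; when $k>n$ (so that no such vectors exist), $k$-transitive means by convention $\mathcal{L}=\mathbb{M}_{mn}$. With this convention, $\mathcal{L}$ is $k$-transitive if and only if its pre-annihilator $\mathcal{L}_\perp=\{T\in\mathbb{M}_{nm}:\operatorname{Tr}(AT)=0\text{ for all }A\in\mathcal{L}\}$ contains no nonzero element of rank at most $k$ (Azoff). For subspaces $\mathcal{L}\subseteq\mathbb{M}_{lp}$ and $\mathcal{M}\subseteq\mathbb{M}_{mn}$, $\mathcal{L}\otimes\mathcal{M}$ is the linear span of the Kronecker products $L\otimes M$ ($L\in\mathcal{L}$, $M\in\mathcal{M}$), a subspace of $\mathbb{M}_{lp}\otimes\mathbb{M}_{mn}\cong\mathbb{M}_{lm,pn}$, i.e. of the linear maps $\mathbb{C}^p\otimes\mathbb{C}^n\to\mathbb{C}^l\otimes\mathbb{C}^m$.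 *)

(* Defs.v *)
From mathcomp Require Import all_boot all_order all_algebra.
From mathcomp Require Import classical_sets.
From mathcomp Require Import mxtens.

Set Implicit Arguments.
Unset Strict Implicit.
Unset Printing Implicit Defensive.

Import GRing.Theory.

Local Open Scope classical_set_scope.
Local Open Scope ring_scope.

(* Linear span of an arbitrary, possibly infinite, set of vectors; the span
   <<s>> of vector.v is defined only for finite sequences. *)
Definition linspan (F : fieldType) (V : vectType F) (S : set V) : set V :=
  [set v | exists2 s : seq V, [set` s] `<=` S & v \in <<s>>%VS].

(* Vectors are columns, so that a matrix in 'M_(m, n) acts by left
   multiplication as a linear map F^n -> F^m. *)
Definition ktransitive (F : fieldType) (k m n : nat)
    (L : set 'M[F]_(m, n)) : Prop :=
  if (k <= n)%N then
    forall (x : k.-tuple 'cV[F]_n) (y : k.-tuple 'cV[F]_m), free x ->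
      exists2 A, L A & forall i : 'I_k, A *m tnth x i = tnth y i
  else L = setT.

(* [L *t M] is the Kronecker product of mxtens.v. *)
Definition tensor_space (F : fieldType) (l p m n : nat)
    (LL : set 'M[F]_(l, p)) (MM : set 'M[F]_(m, n)) :
    set 'M[F]_(l * m, p * n) :=
  linspan [set L *t M | L in LL & M in MM].

(* Main.v *)
Require Import Defs.
From HB Require Import structures.
From mathcomp Require Import all_boot all_order all_algebra.
From mathcomp Require Import classical_sets reals.
From mathcomp Require Import complex.
From mathcomp Require Import mxtens.

Set Implicit Arguments.
Unset Strict Implicit.
Unset Printing Implicit Defensive.

Import GRing.Theory.

Local Open Scope classical_set_scope.
Local Open Scope ring_scope.
Local Open Scope complex_scope.

(** A subspace is k-transitive exactly when no nonzero matrix of rank at most k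
    annihilates it under the trace pairing (A, T) |-> tr (A T)
    ([ktransitive_annihilator], [annihilator_ktransitive]).  It therefore
    suffices to show that a T of rank at most k which annihilates all A *t B,
    with A in LL and B in MM, is zero.  The two tensor factors are handled one
    after the other, by the same argument.

    First let A in LL have rank r.  Writing A as a sum of r rank-one matrices
    turns B |-> A *t B into a sum of r maps B |-> P_i B Q_i, so that
    tr ((A *t B) T) = tr (B S) where S = \sum_i Q_i T P_i is the partial trace
    of T against A.  Each summand has rank at most k, so S has rank at most
    r * k; it annihilates MM, which is r * k-transitive, so S = 0
    ([tensor_annihilatorr]).  Thus tr ((A *t B) T) = 0 for every matrix B, first
    for A of rank r and then, by linearity in A, for every A in LL.

    Now let B be any matrix unit.  Its rank is one, and the same argument with
    the factors exchanged ([tensor_annihilatorl]) only needs LL to be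
    k-transitive: tr ((A *t B) T) = 0 for all A.  Taking matrix units for A as
    well gives all the entries of T. *)

(** * The trace pairing *)

Lemma trace_delta_mx (F : fieldType) m n (i : 'I_m) (j : 'I_n)
    (T : 'M[F]_(n, m)) :
  \tr (delta_mx i j *m T) = T j i.
Proof.
rewrite /mxtrace (bigD1 i) //= big1 => [|i' /negPf ne_i'i].
  rewrite addr0 mxE (bigD1 j) //= big1 => [|j' /negPf ne_j'j].
    by rewrite !mxE !eqxx mul1r addr0.
  by rewrite mxE ne_j'j andbF mul0r.
by rewrite mxE big1 // => j' _; rewrite mxE ne_i'i mul0r.
Qed.

Lemma eq0_trace_mul (F : fieldType) m n (T : 'M[F]_(n, m)) :
  (forall A : 'M_(m, n), \tr (A *m T) = 0) -> T = 0.
Proof.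
by move=> T0; apply/matrixP => j i; rewrite -trace_delta_mx T0 mxE.
Qed.

Lemma trace_functional (F : fieldType) m n
    (f : {linear 'M[F]_(m, n) -> F^o}) :
  exists T : 'M_(n, m), forall A, f A = \tr (A *m T).
Proof.
exists (\matrix_(j, i) f (delta_mx i j)) => A.
rewrite {1}[A]matrix_sum_delta linear_sum; apply: eq_bigr => i _.
rewrite linear_sum mxE; apply: eq_bigr => j _.
by rewrite linearZ mxE.
Qed.

(** The projection away from [U] is zero on [U] but not at [Y], so some entry of
    it is a linear functional that separates [Y] from [U]; the trace pairing
    represents that functional by a matrix. *)
Lemma trace_separation (F : fieldType) m n (U : {vspace 'M[F]_(m, n)})
    (Y : 'M[F]_(m, n)) :
  Y \notin U ->
  exists2 T : 'M_(n, m), (forall A, A \in U -> \tr (A *m T) = 0) &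
    \tr (Y *m T) != 0.
Proof.
move=> YU; pose g := (\1 - projv U)%VF.
have gU A : A \in U -> g A = 0.
  by move=> AU; rewrite add_lfunE opp_lfunE id_lfunE projv_id ?subrr.
have gY : g Y != 0.
  rewrite add_lfunE opp_lfunE id_lfunE subr_eq0; apply: contraNneq YU => ->.
  exact: memv_proj.
have [[i j] /= gYij] : exists ij : 'I_m * 'I_n, g Y ij.1 ij.2 != 0.
  apply/existsP; apply: contraNT gY => /existsPn g0.
  apply/eqP/matrixP => i j; rewrite mxE; apply/eqP.
  exact: negbNE (g0 (i, j)).
pose h A : F^o := g A i j.
have h_lin : linear h by move=> a A B; rewrite /h linearP !mxE.
pose hL := GRing.isLinear.Build _ _ _ _ h h_lin.
pose f : {linear 'M[F]_(m, n) -> F^o} := HB.pack h hL.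
have [T fT] := trace_functional f.
by exists T => [A AU|]; rewrite -fT // /f /= /h gU // mxE.
Qed.

(** * Transitivity and annihilators of small rank *)

Definition cols_mx (F : fieldType) k n (x : k.-tuple 'cV[F]_n) : 'M[F]_(n, k) :=
  \matrix_(i, j) tnth x j i 0.

Lemma col_cols_mx (F : fieldType) k n (x : k.-tuple 'cV[F]_n) i :
  col i (cols_mx x) = tnth x i.
Proof. by apply/colP => j; rewrite !mxE. Qed.

Lemma mulmx_cols_mx (F : fieldType) m k n (A : 'M[F]_(m, n))
    (x : k.-tuple 'cV[F]_n) (y : k.-tuple 'cV[F]_m) :
  (forall i, A *m tnth x i = tnth y i) <-> A *m cols_mx x = cols_mx y.
Proof.
have eA i : A *m tnth x i = col i (A *m cols_mx x).
  by rewrite -col_cols_mx !colE mulmxA.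
split=> [Axy|Axy i]; last by rewrite eA Axy col_cols_mx.
by apply/matrixP => j i; have /colP/(_ j) := Axy i; rewrite eA !mxE.
Qed.

Lemma free_cols_mx (F : fieldType) k n (x : k.-tuple 'cV[F]_n) :
  free x = row_free (cols_mx x)^T.
Proof.
have eq_lin (c : 'I_k -> F) :
    (\sum_i c i *: x`_i)^T = (\row_i c i) *m (cols_mx x)^T.
  rewrite linear_sum mulmx_sum_row; apply: eq_bigr => i _.
  by rewrite mxE -tnth_nth -col_cols_mx linearZ /= tr_col.
apply/freeP/idP => [xfree|xfree c c0 i].
  apply: inj_row_free => v v0; apply/rowP => i; rewrite [RHS]mxE.
  apply: (xfree (v 0)); apply: trmx_inj.
  rewrite eq_lin trmx0 -[RHS]v0; congr (_ *m _).
  by apply/rowP => j; rewrite mxE.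
have /eqP/rowP/(_ i) : \row_i c i == 0.
  by rewrite -(mulmx_free_eq0 _ xfree) -eq_lin c0 trmx0.
by rewrite !mxE.
Qed.

(** Since T has rank at most k <= n, it factors as C D with k linearly
    independent columns in C.  Transitivity provides A in L taking these columns
    to those of any prescribed Y, and then tr (Y D) = tr (A T) = 0, whence
    D = 0. *)
Lemma ktransitive_annihilator (F : fieldType) k m n (L : set 'M[F]_(m, n))
    (T : 'M[F]_(n, m)) :
  ktransitive k L -> (\rank T <= k)%N ->
  (forall A, L A -> \tr (A *m T) = 0) -> T = 0.
Proof.
rewrite /ktransitive; case: leqP => [le_kn|_] Lk Tk LT; last first.
  by apply: eq0_trace_mul => A; apply: LT; rewrite Lk.
(* [col_base T] would have only [\rank T] columns; the first k columns of the
   invertible [col_ebase T] pad it to exactly k independent ones. *)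
pose C : 'M[F]_(n, k) := col_ebase T *m pid_mx k.
pose D : 'M[F]_(k, m) := pid_mx (\rank T) *m row_ebase T.
have TE : T = C *m D.
  rewrite /C /D mulmxA -(mulmxA _ (pid_mx k)) mul_pid_mx.
  by rewrite (minn_idPr _) (minn_idPr Tk) // mulmx_ebase.
suff D0 : D = 0 by rewrite TE D0 mulmx0.
apply: eq0_trace_mul => Y.
pose cols a (X : 'M[F]_(a, k)) := [tuple col i X | i < k].
have colsK a (X : 'M[F]_(a, k)) : cols_mx (cols a X) = X.
  by apply/matrixP => i j; rewrite mxE tnth_mktuple mxE.
have Cfree : free (cols n C).
  rewrite free_cols_mx colsK; apply/row_freeP.
  exists (invmx (col_ebase T)^T *m pid_mx k).
  rewrite trmx_mul mulmxA -(mulmxA _ _^T) mulmxV ?unitmx_tr ?col_ebase_unit //.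
  by rewrite mulmx1 tr_pid_mx pid_mx_id // pid_mx_1.
have [A LA /mulmx_cols_mx] := Lk (cols n C) (cols m Y) Cfree.
by rewrite !colsK => <-; rewrite -mulmxA -TE LT.
Qed.

(** If some Y is not of the form A X with A in U, where X has the columns x,
    separation gives D with tr (A X D) = 0 on U and tr (Y D) != 0; but X D is an
    annihilator of U of rank at most k, so it is zero, and X is injective.
    The set L is allowed to exceed the subspace U so that the lemma applies to
    a span that is given only as a set. *)
Lemma annihilator_ktransitive (F : fieldType) k m n
    (U : {vspace 'M[F]_(m, n)}) (L : set 'M[F]_(m, n)) :
  [set` U] `<=` L ->
  (forall T : 'M_(n, m), (\rank T <= k)%N ->
     (forall A, A \in U -> \tr (A *m T) = 0) -> T = 0) ->
  ktransitive k L.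
Proof.
move=> UL U0; rewrite /ktransitive; case: leqP => [le_kn|lt_nk].
  move=> x y xfree; pose W := (linfun (mulmxr (cols_mx x)) @: U)%VS.
  have [|yW] := boolP (cols_mx y \in W).
    case/memv_imgP => A AU; rewrite lfunE /= => yE.
    by exists A; [exact: UL|apply/mulmx_cols_mx].
  have [D WD] := trace_separation yW; case/negP.
  suff -> : D = 0 by rewrite mulmx0 mxtrace0.
  have xD0 : cols_mx x *m D = 0.
    apply: U0 => [|A AU].
      exact: leq_trans (mxrankM_maxl _ _) (rank_leq_col _).
    rewrite mulmxA; apply: WD; apply/memv_imgP.
    by exists A; rewrite ?lfunE.
  (* E^T is a left inverse of the matrix with columns x. *)
  move: xfree; rewrite free_cols_mx => /row_freeP[E xE].
  apply: trmx_inj; rewrite -[LHS]mulmx1 -xE mulmxA -trmx_mul xD0.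
  by rewrite !trmx0 mul0mx.
apply/seteqP; split=> // Y _; apply: UL => /=.
apply: contraT => YU; have [T UT] := trace_separation YU; case/negP.
rewrite (U0 T) ?mulmx0 ?mxtrace0 //.
exact: leq_trans (rank_leq_row _) (ltnW lt_nk).
Qed.

(** * Contracting one tensor factor *)

Lemma mxrank_sum_leq (F : fieldType) m n k r (T : 'I_r -> 'M[F]_(m, n)) :
  (forall i, (\rank (T i) <= k)%N) -> (\rank (\sum_i T i)%R <= r * k)%N.
Proof.
move=> Tk; apply: (@leq_trans (\sum_(i < r) \rank (T i))).
  elim/big_ind2: _ => [|S a S' a' Sa S'a'|//]; first by rewrite mxrank0.
  exact: leq_trans (mxrank_add _ _) (leq_add Sa S'a').
by rewrite -[X in (X * k)%N]card_ord -sum_nat_const leq_sum.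
Qed.

(** By cyclicity of the trace the functional A |-> tr ((\sum_i P_i A Q_i) T) is
    represented by \sum_i Q_i T P_i, a sum of r matrices of rank at most k. *)
Lemma ktransitive_sandwich (F : fieldType) k r m n a b
    (L : set 'M[F]_(m, n)) (P : 'I_r -> 'M[F]_(a, m)) (Q : 'I_r -> 'M[F]_(n, b))
    (T : 'M[F]_(b, a)) :
  ktransitive (r * k) L -> (\rank T <= k)%N ->
  (forall A, L A -> \tr ((\sum_i P i *m A *m Q i) *m T) = 0) ->
  forall A, \tr ((\sum_i P i *m A *m Q i) *m T) = 0.
Proof.
move=> Lrk Tk LT A.
have trE B : \tr ((\sum_i P i *m B *m Q i) *m T)
    = \tr (B *m \sum_i (Q i *m T *m P i)).
  rewrite mulmx_suml mulmx_sumr !linear_sum; apply: eq_bigr => i _ /=.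
  by rewrite -!mulmxA mxtrace_mulC !mulmxA.
rewrite trE; suff -> : \sum_i (Q i *m T *m P i) = 0 by rewrite mulmx0 mxtrace0.
apply: (ktransitive_annihilator Lrk) => [|B LB]; last by rewrite -trE LT.
apply: mxrank_sum_leq => i.
exact: leq_trans (mxrankM_maxl _ _) (leq_trans (mxrankM_maxr _ _) Tk).
Qed.

Lemma sum_rank1 (F : fieldType) m n (A : 'M[F]_(m, n)) :
  A = \sum_(i < \rank A) col i (col_base A) *m row i (row_base A).
Proof.
rewrite -[LHS]mulmx_base; apply/matrixP => x y; rewrite summxE mxE.
apply: eq_bigr => i _; rewrite [RHS]mxE big_ord1.
by rewrite [col _ _ _ _]mxE [row _ _ _ _]mxE.
Qed.

(** The Kronecker product with a 1 x 1 matrix changes the dimension m to 1 * m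
    or m * 1; this moves the resulting cast from the middle factor, which varies,
    to the outer ones, which are fixed. *)
Lemma mulmx_castmx_sandwich (F : fieldType) a b m n m' n'
    (em : m = m') (en : n = n') (P : 'M[F]_(a, m')) (B : 'M[F]_(m, n))
    (Q : 'M[F]_(n', b)) :
  P *m castmx (em, en) B *m Q
  = castmx (erefl, esym em) P *m B *m castmx (esym en, erefl) Q.
Proof. by case: m' / em P; case: n' / en Q => Q P; rewrite !castmx_id. Qed.

(** For a rank-one matrix, (c d) *t B = (c *t 1) (1 *t B) (d *t 1) where the
    middle factor is B itself up to a cast; sum over a rank-one decomposition of
    A. *)
Lemma tensmx_sandwichl (F : fieldType) l p m n (A : 'M[F]_(l, p)) :
  exists (P : 'I_(\rank A) -> 'M[F]_(l * m, m))
         (Q : 'I_(\rank A) -> 'M[F]_(n, p * n)),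
    forall B, A *t B = \sum_i P i *m B *m Q i.
Proof.
exists (fun i => castmx (erefl, esym (esym (mul1n m)))
                   (col i (col_base A) *t (1%:M : 'M_m))).
exists (fun i => castmx (esym (esym (mul1n n)), erefl)
                   (row i (row_base A) *t (1%:M : 'M_n))).
move=> B; under eq_bigr => i _ do
  rewrite -mulmx_castmx_sandwich -tens_scalar1mx !tensmx_mul.
under eq_bigr => i _ do rewrite mulmx1 mul1mx mulmx1.
rewrite {1}[A]sum_rank1; apply/matrixP => x y; rewrite mxE !summxE mulr_suml.
by apply: eq_bigr => i _; rewrite [RHS]mxE.
Qed.

Lemma tensmx_sandwichr (F : fieldType) l p m n (B : 'M[F]_(m, n)) :
  exists (P : 'I_(\rank B) -> 'M[F]_(l * m, l))
         (Q : 'I_(\rank B) -> 'M[F]_(p, p * n)),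
    forall A, A *t B = \sum_i P i *m A *m Q i.
Proof.
exists (fun i => castmx (erefl, esym (esym (muln1 l)))
                   ((1%:M : 'M_l) *t col i (col_base B))).
exists (fun i => castmx (esym (esym (muln1 p)), erefl)
                   ((1%:M : 'M_p) *t row i (row_base B))).
move=> A; under eq_bigr => i _ do
  rewrite -mulmx_castmx_sandwich -[A in castmx _ A]scale1r -tens_mx_scalar
    !tensmx_mul.
under eq_bigr => i _ do rewrite mulmx1 mul1mx mulmx1.
rewrite {1}[B]sum_rank1; apply/matrixP => x y; rewrite mxE !summxE mulr_sumr.
by apply: eq_bigr => i _; rewrite [RHS]mxE.
Qed.

Lemma tensor_annihilatorr (F : fieldType) k l p m n (A : 'M[F]_(l, p))
    (MM : set 'M[F]_(m, n)) (T : 'M[F]_(p * n, l * m)) :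
  ktransitive (\rank A * k) MM -> (\rank T <= k)%N ->
  (forall B, MM B -> \tr ((A *t B) *m T) = 0) ->
  forall B, \tr ((A *t B) *m T) = 0.
Proof.
have [P [Q AE]] := tensmx_sandwichl m n A.
move=> Mk Tk MT B; rewrite AE; apply: (ktransitive_sandwich Mk) => // B' MB'.
by rewrite -AE MT.
Qed.

Lemma tensor_annihilatorl (F : fieldType) k l p m n (B : 'M[F]_(m, n))
    (LL : set 'M[F]_(l, p)) (T : 'M[F]_(p * n, l * m)) :
  ktransitive (\rank B * k) LL -> (\rank T <= k)%N ->
  (forall A, LL A -> \tr ((A *t B) *m T) = 0) ->
  forall A, \tr ((A *t B) *m T) = 0.
Proof.
have [P [Q BE]] := tensmx_sandwichr l p B.
move=> Lk Tk LT A; rewrite BE; apply: (ktransitive_sandwich Lk) => // A' LA'.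
by rewrite -BE LT.
Qed.

Lemma tensmx_delta (F : fieldType) l p m n (i : 'I_l) (j : 'I_p) (i' : 'I_m)
    (j' : 'I_n) :
  delta_mx i j *t delta_mx i' j'
  = delta_mx (mxtens_index (i, i')) (mxtens_index (j, j')) :> 'M[F]_(_, _).
Proof.
apply/matrixP => x y; case: (mxtens_indexP x) => x1 x2.
case: (mxtens_indexP y) => y1 y2; rewrite tensmxE !mxE.
rewrite !(can_eq (@mxtens_indexK _ _)) !xpair_eqE.
by rewrite -natrM mulnb andbACA.
Qed.

(** * The tensor product of subspaces *)

(** This is how spanning by the elements of rank r is used: the vanishing of a
    functional on these elements extends to the whole subspace. *)
Lemma linear_eq0_linspan (F : fieldType) (V : vectType F) (S : set V)
    (W : lmodType F) (f : {linear V -> W}) :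
  (forall v, S v -> f v = 0) -> forall v, linspan S v -> f v = 0.
Proof.
move=> fS v [s sS vs]; rewrite (coord_span (X := in_tuple s) vs).
rewrite linear_sum big1 // => i _.
by rewrite linearZ /= fS ?scaler0 //; apply/sS/mem_nth.
Qed.

(** Products of basis elements span a subspace given by a finite list, which
    makes separation from a subspace available for the set [tensor_space]. *)
Definition tensv (F : fieldType) l p m n (LL : {vspace 'M[F]_(l, p)})
    (MM : {vspace 'M[F]_(m, n)}) : {vspace 'M[F]_(l * m, p * n)} :=
  <<[seq A *t B | A <- vbasis LL, B <- vbasis MM]>>%VS.

Lemma tensv_sub (F : fieldType) l p m n (LL : {vspace 'M[F]_(l, p)})
    (MM : {vspace 'M[F]_(m, n)}) :
  [set` tensv LL MM] `<=` tensor_space [set` LL] [set` MM].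
Proof.
move=> T TU; exists [seq A *t B | A <- vbasis LL, B <- vbasis MM] => //.
move=> _ /= /allpairsP[[A B] [/vbasis_mem AL /vbasis_mem BM ->]].
by exists A => //; exists B.
Qed.

Lemma mem_tensv (F : fieldType) l p m n (LL : {vspace 'M[F]_(l, p)})
    (MM : {vspace 'M[F]_(m, n)}) A B :
  A \in LL -> B \in MM -> A *t B \in tensv LL MM.
Proof.
move=> /coord_vbasis-> /coord_vbasis->.
have tensE (a : 'I_(\dim LL) -> F) (b : 'I_(\dim MM) -> F) :
    (\sum_i a i *: (vbasis LL)`_i) *t (\sum_j b j *: (vbasis MM)`_j)
    = \sum_i \sum_j (a i * b j) *: ((vbasis LL)`_i *t (vbasis MM)`_j).
  apply/matrixP => x y; rewrite mxE !summxE mulr_suml; apply: eq_bigr => i _.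
  rewrite mulr_sumr summxE; apply: eq_bigr => j _.
  by rewrite !mxE mulrACA.
rewrite tensE; apply: memv_suml => i _; apply: memv_suml => j _.
apply/memvZ/memv_span.
by apply/allpairsP; exists ((vbasis LL)`_i, (vbasis MM)`_j); split=> //;
  apply: mem_nth; rewrite size_tuple.
Qed.

Theorem theorem3p2 (R : realType) (l p m n k r : nat)
    (hl : (0 < l)%N) (hp : (0 < p)%N) (hm : (0 < m)%N) (hn : (0 < n)%N)
    (hk : (0 < k)%N) (hr : (0 < r)%N)
    (LL : {vspace 'M[R[i]]_(l, p)}) (MM : {vspace 'M[R[i]]_(m, n)})
    (hLk : ktransitive k [set` LL])
    (hLr : [set` LL] = linspan [set A | A \in LL /\ \rank A = r])
    (hM : ktransitive (r * k) [set` MM]) :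
  ktransitive k (tensor_space [set` LL] [set` MM]).
Proof.
apply: (annihilator_ktransitive (@tensv_sub _ _ _ _ _ LL MM)) => T Tk UT.
(* The contraction of T against any A in LL vanishes: it suffices to see this
   for A of rank r. *)
have LT A B : A \in LL -> \tr ((A *t B) *m T) = 0.
  move=> AL; pose f A : R[i]^o := \tr ((A *t B) *m T).
  have f_lin : linear f.
    move=> a A1 A2; rewrite /f; have -> : (a *: A1 + A2) *t B
        = a *: (A1 *t B) + A2 *t B.
      by apply/matrixP => x y; rewrite !mxE mulrDl mulrA.
    by rewrite mulmxDl -scalemxAl mxtraceD mxtraceZ.
  pose fL := GRing.isLinear.Build _ _ _ _ f f_lin.
  pose g : {linear 'M[R[i]]_(l, p) -> R[i]^o} := HB.pack f fL.
  have : linspan [set A | A \in LL /\ \rank A = r] A by rewrite -hLr.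
  apply: (linear_eq0_linspan (f := g)) => A' [A'L rA'] /=.
  move: hM; rewrite -rA' => hM'.
  apply: (tensor_annihilatorr hM' Tk) => B' B'M.
  exact/UT/mem_tensv.
(* Each entry of T is its trace pairing with a product of matrix units, and a
   unit in the second factor has rank one. *)
apply/matrixP => x y; case: (mxtens_indexP x) => j j'.
case: (mxtens_indexP y) => i i'; rewrite -trace_delta_mx -tensmx_delta mxE.
apply: (@tensor_annihilatorl _ k _ _ _ _ _ [set` LL]) => // [|A AL].
  by rewrite mxrank_delta mul1n.
exact: LT.
Qed.
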